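(* Let $\alpha\in(0,1)$ and define $T_\alpha=2/\alpha+1$. For any $\phi\in\mathbb Z$, the set $$\mathrm{CI}(X;\alpha,\phi)=\begin{cases}\big(X-T_\alpha|X-\phi|,\ X+T_\alpha|X-\phi|\big)\cap\mathbb Z,&X\ne\phi,\\ \mathbb Z,&X=\phi,\end{cases}$$ computed from one observation $X$, is a weak $(1-\alpha)$-confidence interval for mode. Consequently, if $\phi\ne0$, $$\mathrm{CI}(X;\alpha/2,\phi)\cap\mathrm{CI}(X;\alpha/2,-\phi)$$ is a weak $(1-\alpha)$-confidence interval for mode that is always finite.
   Context: For a probability measure $P$ on $\mathbb Z$, $f_P(n)=P(\{n\})$. For $\theta\in\mathbb Z$, $\mathcal D_\theta$ is the set of probability measures $P$ on $\mathbb Z$ with $f_P(n-1)\le f_P(n)$ if $n\le\theta$, and $f_P(n)\ge f_P(n+1)$ if $n\ge\theta$; $\mathcal D_{\mathbb Z}=\bigcup_{\theta\in\mathbb Z}\mathcal D_\theta$; $M(P)=\{\theta\in\mathbb Z:P\in\mathcal D_\theta\}$ is the set of modes of $P\in\mathcal D_{\mathbb Z}$. A random set $\mathrm{CI}=\mathrm{CI}(X)\subseteq\mathbb Z$ is a weak $(1-\alpha)$-confidence set (interval) for mode if for all $P\in\mathcal D_{\mathbb Z}$ and all $\theta\in M(P)$, $P(\theta\in\mathrm{CI}(X))\ge1-\alpha$, where $X$ has distribution $P$. *)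

(* Defs.v *)
From HB Require Import structures.
From mathcomp Require Import all_boot all_order all_algebra.
From mathcomp Require Import all_classical all_reals all_analysis.

Set Implicit Arguments.
Unset Strict Implicit.
Unset Printing Implicit Defensive.

Import Order.TTheory GRing.Theory Num.Theory.
Import numFieldNormedType.Exports.

Local Open Scope classical_set_scope.
Local Open Scope ring_scope.

HB.instance Definition _ := isPointed.Build int 0.

(* Every subset of the integers is an event. *)
HB.instance Definition _ := @isMeasurable.Build default_measure_display
  int discrete_measurable discrete_measurable0
  discrete_measurableC discrete_measurableU.

Section modes.
Variable R : realType.
Implicit Types (P : probability int R) (theta phi x : int) (alpha : R).

Definition mass P (n : int) : \bar R := P [set n].

Definition unimodal_at theta : set (probability int R) :=
  [set P | (forall n : int, n <= theta -> (mass P (n - 1) <= mass P n)%E) /\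
           (forall n : int, theta <= n -> (mass P (n + 1) <= mass P n)%E)].

Definition unimodal : set (probability int R) :=
  \bigcup_theta unimodal_at theta.

Definition modes P : set int := [set theta | unimodal_at theta P].

(* A random set computed from one observation X is CI X for a set-valued map
   CI; X may live on any probability space, as long as it has law P. *)
Definition weak_confidence_set alpha (CI : int -> set int) : Prop :=
  forall P, unimodal P -> forall theta, modes P theta ->
  forall (d : measure_display) (Omega : measurableType d)
    (Pr : probability Omega R) (X : {RV Pr >-> int}),
    (forall A : set int, distribution Pr X A = P A) ->
    ((1 - alpha)%:E <= Pr [set w | CI (X w) theta])%E.

(* is_interval is order-convexity, here inside the integers. *)
Definition weak_confidence_interval alpha (CI : int -> set int) : Prop :=
  weak_confidence_set alpha CI /\ forall x, is_interval (CI x).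

Definition T_ alpha : R := 2 / alpha + 1.

Definition CI_ alpha phi x : set int :=
  if x == phi then setT
  else [set n : int | n%:~R \in
         `]x%:~R - T_ alpha * `|x - phi|%:~R,
           x%:~R + T_ alpha * `|x - phi|%:~R[ ].

End modes.

(* Main.v *)
(* Let D = |theta - phi|. By the triangle inequality an observation X whose
   interval misses theta satisfies 0 < |X - phi| <= alpha D / 2, so with
   m = floor (alpha D / 2) there are at most 2m bad values. Removing phi
   itself, these lie at the low end of a monotone run towards the mode, which
   also contains at least D - m further points, each at least as likely;
   hence the bad values have mass at most 2m / (D + m) <= alpha. The finite
   set follows by a union bound. *)

Require Import Defs.
From HB Require Import structures.
From mathcomp Require Import all_boot all_order all_algebra.
From mathcomp Require Import all_classical all_reals all_analysis.
From mathcomp Require Import zify ring lra.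

Import Order.TTheory GRing.Theory Num.Theory.
Import numFieldNormedType.Exports.

Local Open Scope classical_set_scope.
Local Open Scope ring_scope.

(** Finite additivity over singletons, stated with real summands so that the later estimates are
    ordinary real arithmetic. *)
Lemma probability_seq (R : realType) (P : probability int R) (s : seq int) :
  uniq s -> P [set` s] = (\sum_(n <- s) fine (mass P n))%:E.
Proof.
elim: s => [|n s IHs] /=; first by rewrite big_nil set_nil measure0.
move=> /andP[ns us]; rewrite big_cons.
have -> : [set` n :: s] = [set n] `|` [set` s].
  by apply/seteqP; split=> x /=; rewrite inE => /predU1P.
rewrite measureU //=.
- by rewrite IHs // EFinD /mass fineK // fin_num_measure.
- by rewrite -subset0 => x /= [-> sn]; move: ns; rewrite sn.
Qed.

Lemma sumr_const_size (V : nmodType) (T : Type) (s : seq T) (t : V) :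
  \sum_(n <- s) t = t *+ size s.
Proof. by rewrite big_const_seq count_predT iter_addr_0. Qed.

Lemma ler_sum_size (R : realDomainType) (T : eqType) (s : seq T) (f : T -> R) t :
  {in s, forall n, f n <= t} -> \sum_(n <- s) f n <= (size s)%:R * t.
Proof.
move=> ft; rewrite mulr_natl -sumr_const_size.
by rewrite big_seq [leRHS]big_seq; exact: ler_sum.
Qed.

Lemma size_ler_sum (R : realDomainType) (T : eqType) (s : seq T) (f : T -> R) t :
  {in s, forall n, t <= f n} -> (size s)%:R * t <= \sum_(n <- s) f n.
Proof.
move=> tf; rewrite mulr_natl -sumr_const_size.
by rewrite big_seq [leRHS]big_seq; exact: ler_sum.
Qed.

Lemma nondecreasing_upto (R : realType) (f : int -> R) (D : int) :
  (forall k, k <= D -> f (k - 1) <= f k) ->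
  forall a b, a <= b -> b <= D -> f a <= f b.
Proof.
move=> f1 a b ab; have -> : b = a + `|b - a|%N by lia.
elim: `|b - a|%N => [|n IHn] aD; first by rewrite addr0.
apply: le_trans (f1 _ aD); have -> : a + n.+1%:Z - 1 = a + n by lia.
by apply: IHn; lia.
Qed.

(* The 2m points next to the centre carry mass at most 2mt, where
   t = P {g m}, and the points g (m+1), .., g D carry mass at least (D-m)t;
   eliminating t gives the bound. *)
Lemma punctured_ball_mass (R : realType) (P : probability int R)
    (g : int -> int) (D m : nat) :
  injective g -> (m <= D)%N ->
  (forall k : int, k <= D -> (mass P (g (k - 1)%R) <= mass P (g k))%E) ->
  fine (P (g @` [set k | k != 0 /\ (absz k <= m)%N])) * (D + m)%:R
    <= (2 * m)%:R.
Proof.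
move=> ginj mD gmono.
pose f (k : int) := fine (mass P (g k)).
have fmono (a b : int) : a <= b -> b <= D -> f a <= f b.
  apply: (nondecreasing_upto _ f) => k kD.
  by apply: fine_le; rewrite ?fin_num_measure //; exact: gmono.
(* [near] lists -1, .., -m and 1, .., m; [far] lists m+1, .., D. Indices on both sides of 0 are at
   most m, so monotonicity up to D bounds [f] on all of [near] by [f m]. *)
pose near := [seq - (i%:Z + 1) | i <- iota 0 m] ++
             [seq i%:Z + 1 | i <- iota 0 m].
pose far := [seq i%:Z + 1 | i <- iota m (D - m)].
have near_bound (k : int) : k \in near -> k <= m.
  by rewrite mem_cat => /orP[] /mapP[i]; rewrite mem_iota; lia.
have far_bound (k : int) : k \in far -> m%:Z < k <= D.
  by move=> /mapP[i]; rewrite mem_iota; lia.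
have uniq_far : uniq far by rewrite map_inj_uniq ?iota_uniq // => i j; lia.
have uniq_near : uniq near.
  rewrite cat_uniq !map_inj_uniq ?iota_uniq /= ?andbT; try by move=> i j; lia.
  by apply/hasPn => k /mapP[i _ ->]; apply/mapP => -[j _]; lia.
have uniq_all : uniq (near ++ far).
  rewrite cat_uniq uniq_near uniq_far andbT /=.
  by apply/hasPn => k /far_bound kf; apply/negP => /near_bound; lia.
have -> : g @` [set k | k != 0 /\ (absz k <= m)%N] = [set` map g near].
  apply/seteqP; split => [_ [k /= [k0 km] <-]|_ /= /mapP[k kn ->]].
    apply: map_f; rewrite mem_cat.
    have [k_lt0|k_gt0] : k < 0 \/ 0 < k by lia.
      by apply/orP; left; apply/mapP; exists (absz k).-1; rewrite ?mem_iota; lia.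
    by apply/orP; right; apply/mapP; exists (absz k).-1; rewrite ?mem_iota; lia.
  exists k => //=.
  by move: kn; rewrite mem_cat => /orP[] /mapP[i]; rewrite mem_iota; lia.
rewrite probability_seq ?map_inj_uniq // big_map /=.
have le_near : \sum_(k <- near) f k <= (2 * m)%:R * f m.
  have -> : (2 * m)%N = size near by rewrite size_cat !size_map size_iota; lia.
  by apply: ler_sum_size => k /near_bound km; apply: fmono => //; lia.
have ge_far : (D - m)%:R * f m <= \sum_(k <- far) f k.
  have -> : (D - m)%N = size far by rewrite size_map size_iota.
  by apply: size_ler_sum => k /far_bound km; apply: fmono => //; lia.
have le1 : \sum_(k <- near) f k + \sum_(k <- far) f k <= 1.
  have := @probability_le1 _ _ _ P [set` map g (near ++ far)] I.
  by rewrite probability_seq ?map_inj_uniq // big_map big_cat lee_fin.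
set p := \sum_(k <- near) _ in le_near le1 *.
move: le_near ge_far; rewrite natrB // natrM natrD => le_near ge_far.
have m_ge0 : 0 <= m%:R :> R by [].
have mDR : m%:R <= D%:R :> R by rewrite ler_nat.
(* Scaling [le_near] by D - m, and (D - m) f(m) <= 1 - p by 2m, yields p (D - m) <= 2m (1 - p), that
   is, p (D + m) <= 2m. *)
have := ler_wpM2l (_ : 0 <= D%:R - m%:R) le_near.
rewrite subr_ge0 => /(_ mDR) h1.
have : 2%:R * m%:R * ((D%:R - m%:R) * f m) <= 2%:R * m%:R * (1 - p).
  apply: ler_wpM2l; first by rewrite mulr_ge0.
  by lra.
by lra.
Qed.

(** The summand 1 in [T_ alpha] absorbs the term [|x - phi|] of the triangle inequality, leaving the
    factor 2 / alpha. *)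
Lemma not_CI_near (R : realType) (alpha : R) (phi theta x : int) :
  0 < alpha -> ~ CI_ alpha phi x theta ->
  x != phi /\ `|x - phi|%:~R <= alpha / 2 * `|theta - phi|%:~R.
Proof.
rewrite /CI_ => a0; case: eqP => [_ /(_ I) //|xphi /= out]; split=> //.
have far : T_ alpha * `|x - phi|%:~R <= `|x - theta|%:~R.
  rewrite leNgt; apply/negP => lt_T; apply: out; rewrite in_itv /=.
  move: lt_T; rewrite intr_norm rmorphB /= ltr_norml.
  by move=> /andP[? ?]; apply/andP; split; lra.
have tri : `|x - theta|%:~R <= `|x - phi|%:~R + `|theta - phi|%:~R :> R.
  by rewrite -rmorphD /= ler_int; lia.
have : 2 / alpha * `|x - phi|%:~R <= `|theta - phi|%:~R.
  by move: far; rewrite /T_ mulrDl mul1r; lra.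
rewrite -(ler_pM2l (_ : 0 < alpha / 2)) ?divr_gt0 // mulrA.
by rewrite (_ : alpha / 2 * (2 / alpha) = 1) ?mul1r //; field; rewrite gt_eqF.
Qed.

Lemma not_CI_mass (R : realType) (P : probability int R) (alpha : R)
    (phi theta : int) :
  0 < alpha -> alpha < 1 -> unimodal_at theta P ->
  (P [set x | ~ CI_ alpha phi x theta] <= alpha%:E)%E.
Proof.
move=> a0 a1 [Pl Pr].
pose D := absz (theta - phi); pose r : R := alpha / 2 * D%:R.
(* The sign [s] orients the line so that [g] walks from phi at index 0 to theta at index D; both
   halves of unimodality then become one monotone run. *)
pose s : int := if phi <= theta then 1 else - 1.
pose g k := phi + s * k.
(* An integer distance is at most [r] exactly when it is at most [m]; also m <= D since alpha / 2 <
   1. *)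
pose m := Num.trunc r.
have r_ge0 : 0 <= r by rewrite mulr_ge0 // divr_ge0 // ltW.
have mr : m%:R <= r by rewrite /m truncn_le.
have normD : `|theta - phi| = D :> int by rewrite /D; lia.
have mD : (m <= D)%N.
  rewrite -(ler_nat R) (le_trans mr) // /r ler_piMl //; lra.
have sE : s = 1 \/ s = - 1 by rewrite /s; case: ifP; [left|right].
have ginj : injective g by move=> k l; rewrite /g; case: sE => ->; lia.
have gmono (k : int) : k <= D -> (mass P (g (k - 1)%R) <= mass P (g k))%E.
  rewrite /g /s /D; case: ifPn => [le_pt|lt_tp] kD.
    have -> : phi + 1 * (k - 1) = phi + 1 * k - 1 by lia.
    by apply: Pl; lia.
  have -> : phi + - 1 * (k - 1) = phi + - 1 * k + 1 by lia.
  by apply: Pr; lia.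
have := punctured_ball_mass _ _ _ _ _ ginj mD gmono.
set B := g @` _ => PB.
have subB : [set x | ~ CI_ alpha phi x theta] `<=` B.
  move=> x /= /not_CI_near[] // xphi; rewrite normD => xr.
  exists (s * (x - phi)) => /=; last by rewrite /g; case: sE => ->; lia.
  split; first by case: sE => ->; lia.
  have -> : absz (s * (x - phi)) = absz (x - phi) by case: sE => ->; lia.
  by rewrite truncn_ge_nat // (le_trans _ xr).
apply: (@le_trans _ _ (P B)); first by apply: le_measure; rewrite ?inE.
have PBfin : P B \is a fin_num by rewrite fin_num_measure.
rewrite -(fineK PBfin) lee_fin.
(* If theta = phi, then m = 0 and the punctured ball is empty; otherwise D can be cancelled. *)
have [D0|D_gt0] := posnP D.
  have B0 : B = set0.
    rewrite -subset0 => _ [k /= [k0 km] _]; move: mD; rewrite D0; lia.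
  by rewrite B0 measure0 ltW.
have D_gt0R : 0 < D%:R :> R by rewrite ltr0n.
(* The chain is P(B) D <= P(B) (D + m) <= 2m <= 2r = alpha D. *)
rewrite -(ler_pM2r D_gt0R) (le_trans _ (_ : (2 * m)%:R <= _)) //.
  apply: le_trans PB; apply: ler_wpM2l; first exact: fine_ge0.
  by rewrite ler_nat; lia.
by move: mr; rewrite natrM /r; lra.
Qed.

(** Coverage depends on X only through its law, so it can be computed on the integers, where passing
    to the complement is always legitimate. *)
Lemma weak_confidence_setP (R : realType) (alpha : R) (CI : int -> set int) :
  (forall (P : probability int R) theta, unimodal_at theta P ->
     (P [set x | ~ CI x theta] <= alpha%:E)%E) ->
  weak_confidence_set alpha CI.
Proof.
move=> miss P _ theta Ptheta d Omega Pr X XP.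
have -> : Pr [set w | CI (X w) theta] = P [set x | CI x theta] by rewrite -XP.
have -> : [set x | CI x theta] = ~` [set x | ~ CI x theta].
  by apply/seteqP; split => x /= => [? //|/contrapT].
rewrite probability_setC // EFinB; apply: leeB => //.
exact: miss.
Qed.

Lemma CI_interval (R : realType) (alpha : R) (phi x : int) :
  is_interval (CI_ alpha phi x).
Proof.
rewrite /CI_; case: ifP => // _ a b /=; rewrite !in_itv /=.
move=> /andP[la _] /andP[_ bu] z /andP[az zb] /=; rewrite in_itv /=.
by rewrite (lt_le_trans la) ?ler_int //= (le_lt_trans _ bu) ?ler_int.
Qed.

Lemma CI_finite (R : realType) (alpha : R) (phi x : int) :
  x != phi -> finite_set (CI_ alpha phi x).
Proof.
move=> xphi; rewrite /CI_ (negbTE xphi).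
set r := T_ alpha * _.
have [N rN] : exists N : nat, r < N%:R.
  by exists (Num.bound `|r|); rewrite (le_lt_trans (ler_norm r)) // archi_boundP.
(* With N above the half-width, the interval lies in x - N, .., x + N - 1. *)
apply: (@sub_finite_set _ _ ((fun i : nat => x - N%:Z + i%:Z) @` `I_(2 * N))).
  move=> n /=; rewrite in_itv /= => /andP[ln nu].
  have xn : x - N%:Z < n < x + N%:Z.
    by rewrite -!(ltr_int R) !rmorphB rmorphD /= -!pmulrn; lra.
  by exists (absz (n - x + N%:Z)); lia.
exact/finite_image/finite_II.
Qed.

Theorem corollary3p10 (R : realType) (alpha : R)
    (alpha_gt0 : 0 < alpha) (alpha_lt1 : alpha < 1) (phi : int) :
  weak_confidence_interval alpha (CI_ alpha phi) /\
  (phi != 0 ->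
     weak_confidence_interval alpha
       (fun x => CI_ (alpha / 2) phi x `&` CI_ (alpha / 2) (- phi) x) /\
     forall x : int,
       finite_set (CI_ (alpha / 2) phi x `&` CI_ (alpha / 2) (- phi) x)).
Proof.
split.
  split; last exact: CI_interval.
  by apply: weak_confidence_setP => P theta; exact: not_CI_mass.
move=> phi0; split; [split|].
- apply: weak_confidence_setP => P theta Ptheta.
  (* Missing the intersection means missing one of the two sets, each at cost at most alpha / 2. *)
  have -> : [set x | ~ (CI_ (alpha / 2) phi x `&` CI_ (alpha / 2) (- phi) x) theta]
      = [set x | ~ CI_ (alpha / 2) phi x theta] `|`
        [set x | ~ CI_ (alpha / 2) (- phi) x theta].
    by apply/seteqP; split=> x /=; rewrite not_andP.
  rewrite (le_trans (measureU2 P _ _)) // [alpha in leRHS]splitr EFinD.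
  by apply: leeD; apply: not_CI_mass => //; lra.
- move=> x a b [a1 a2] [b1 b2] z az.
  by split; [exact: CI_interval a1 b1 z az|exact: CI_interval a2 b2 z az].
(* As phi and -phi differ, x avoids at least one of these centres, and the set for that centre is
   finite. *)
- move=> x; have [xphi|xphi] := eqVneq x phi.
    apply: sub_finite_set (@subIsetr _ _ _) _.
    by apply: CI_finite; lia.
  by apply: sub_finite_set (@subIsetl _ _ _) _; exact: CI_finite.
Qed.
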